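(* Let $X\in\mathbb{C}^{d\times d}$ have all eigenvalues real. Let $f\in C^{d-1}(\mathbb{R})$ be $2\pi$-periodic. Then $$\lim_{n\to\infty}\frac1n\sum_{m=0}^{n-1}\sum_{k=-m}^{m}\widehat f(k)\,e^{ikX}=f(X).$$
   Context: $C^{d-1}(\mathbb{R})$ denotes the $(d-1)$-times continuously differentiable complex-valued functions on $\mathbb{R}$. The Fourier coefficients are $\widehat f(k)=\frac1{2\pi}\int_{-\pi}^{\pi}f(x)e^{-ikx}\,dx$, $k\in\mathbb{Z}$. $e^{ikX}$ is the matrix exponential. $X$ is not assumed diagonalizable. $f(X)$ is the usual matrix function defined through the Jordan decomposition: if $X=W\operatorname{diag}(J_1,\dots,J_r)W^{-1}$ with Jordan blocks $J_1,\dots,J_r$, then $f(X)=W\operatorname{diag}(f(J_1),\dots,f(J_r))W^{-1}$, where for a Jordan block $J$ of size $p\times p$ with eigenvalue $\lambda$ (and ones on the superdiagonal) $f(J)$ is the upper triangular matrix with $(i,j)$ entry $f^{(j-i)}(\lambda)/(j-i)!$ for $j\ge i$ and $0$ for $j<i$. The limit is in any matrix norm. *)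

(* Defs.v *)
From HB Require Import structures.
From mathcomp Require Import all_boot all_order all_algebra.
From mathcomp Require Import all_classical all_reals all_analysis.
From mathcomp Require Export complex.

Set Implicit Arguments.
Unset Strict Implicit.
Unset Printing Implicit Defensive.

Import Order.TTheory GRing.Theory Num.Theory.
Import numFieldNormedType.Exports.

Local Open Scope classical_set_scope.
Local Open Scope ring_scope.
Local Open Scope complex_scope.

(* R[i] packed as a numFieldType: this is the key on which MathComp-Analysis
   attaches the topology of C and, entrywise, that of the matrices over C
   (the one induced by the norm max_(i, j) `|A i j|). *)
Definition Cplx (R : realType) : numFieldType := R[i].

Section complex_valued_functions.
Context {R : realType}.
Implicit Types f : R -> Cplx R.

Definition rpart f : R -> R := fun x => complex.Re (f x).
Definition ipart f : R -> R := fun x => complex.Im (f x).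

(* The derivatives of order < n are continuous, being differentiable. *)
Definition is_Cn_real (n : nat) (g : R -> R) : Prop :=
  (forall k x, (k < n)%N -> derivable (derive1n k g) x 1) /\ continuous (derive1n n g).

Definition is_Cn (n : nat) f : Prop :=
  is_Cn_real n (rpart f) /\ is_Cn_real n (ipart f).

Definition cderiv (k : nat) f : R -> Cplx R :=
  fun x => derive1n k (rpart f) x +i* derive1n k (ipart f) x.

Definition cintegral (A : set R) f : Cplx R :=
  (\int[lebesgue_measure]_(x in A) rpart f x) +i*
  (\int[lebesgue_measure]_(x in A) ipart f x).

Definition cexp (z : Cplx R) : Cplx R :=
  (expR (complex.Re z))%:C * (cos (complex.Im z) +i* sin (complex.Im z)).

Definition fourier_coef f (k : int) : Cplx R :=
  ((2 * pi)^-1)%:C *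
  cintegral `[- pi, pi] (fun x => f x * cexp (- ('i%C * k%:~R * x%:C))).

End complex_valued_functions.

(* The integers -m, ..., m. *)
Definition symm_ints (m : nat) : seq int :=
  [seq j%:Z - m%:Z | j <- iota 0 (2 * m).+1].

Definition expmx {K : numFieldType} {d : nat} (A : 'M[K]_d) : 'M[K]_d :=
  limn (series (fun k => (k`!%:R)^-1 *: A ^+ k)).

Section matrix_functions.
Context {R : realType}.
Implicit Types f : R -> Cplx R.

Definition jordan_block (p : nat) (a : Cplx R) : 'M[Cplx R]_p :=
  \matrix_(i, j) if j == i then a else if j == i.+1 :> nat then 1 else 0.

Definition jordan_block_fun f (p : nat) (a : R) : 'M[Cplx R]_p :=
  \matrix_(i, j) if (i <= j)%N then cderiv (j - i) f a / ((j - i)`!)%:R else 0.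

(* Y = W diag(f(J_1), ..., f(J_r)) W^-1 for some Jordan decomposition
   X = W diag(J_1, ..., J_r) W^-1.  The eigenvalues a i are taken in R because
   f is only defined there; e moves the block-diagonal matrices from size
   \sum_i p i to size d. *)
Definition is_matfun f (d : nat) (X Y : 'M[Cplx R]_d) : Prop :=
  exists (r : nat) (p : 'I_r -> nat) (a : 'I_r -> R)
         (e : (\sum_(i < r) p i)%N = d) (W : 'M[Cplx R]_d),
  [/\ forall i, (0 < p i)%N,
      W \in unitmx,
      X = W *m castmx (e, e) (\mxdiag_(i < r) jordan_block (p i) (a i)%:C)
            *m invmx W &
      Y = W *m castmx (e, e) (\mxdiag_(i < r) jordan_block_fun f (p i) (a i))
            *m invmx W].

(* f(X), which does not depend on the choice of the Jordan decomposition.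
   The default value 0 is taken only if X has a non-real eigenvalue. *)
Definition matfun f (d : nat) (X : 'M[Cplx R]_d) : 'M[Cplx R]_d :=
  xget 0 [set Y | is_matfun f X Y].

End matrix_functions.

(* Main.v *)
Require Import Defs.
From HB Require Import structures.
From mathcomp Require Import all_boot all_order all_algebra.
From mathcomp Require Import all_classical all_reals all_analysis.
From mathcomp Require Import ring lra zify.

(** Fix a Jordan decomposition X = W diag(J_1, ..., J_r) W^-1, where J_i has the
    real eigenvalue a_i, and let E_(i, l) be the conjugate by W of the
    block-diagonal matrix whose i-th block is the l-th power of the nilpotent
    shift, the other blocks being 0. These components satisfy
    1 = sum_i E_(i, 0), X E_(i, l) = a_i E_(i, l) + E_(i, l+1) and E_(i, d) = 0,
    and these three relations alone give
    X^k = sum_(i, l) binomial(k, l) a_i^(k-l) E_(i, l) ([expr_spectral]), hence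
    exp(c X) = sum_(i, l) (c^l / l!) exp(c a_i) E_(i, l) ([expmx_spectral]),
    while f(X) = sum_(i, l) (f^(l)(a_i) / l!) E_(i, l) ([spectral_of_matfun]).
    Addition and scaling of matrices being continuous, it suffices to show that
    for each real a and each l < d the Cesàro means of the partial sums of
    sum_k c_k(f) (ik)^l exp(ika), c_k(f) being the k-th Fourier coefficient,
    converge to f^(l)(a) ([fejer_derivative]).

    Integration by parts over a period gives (ik)^l c_k(f) = c_k(f^(l)), so the
    scalar statement is Fejér's theorem for the continuous periodic function
    f^(l), or rather for its real and imaginary parts ([fejer],
    [complex_fejer]). Fejér's theorem is proved in the manner of Korovkin. The
    sum G_n of the first n Dirichlet kernels is nonnegative and satisfies
    G_n(t) (1 - cos t) = 1 - cos(nt), and a continuous periodic h satisfies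
    |h(x) - h(a)| <= e + M (1 - cos(x - a)) for every e > 0 and a suitable M.
    Integrating against G_n(x - a) / (2 pi n), which has mass 1, bounds the
    error at a by e + M / n.

    It remains to know that f(X) is given by some Jordan decomposition, that is,
    that one exists ([jordan_form]); it does not matter which one is chosen.
    For an eigenvalue a let N = X - a and let p be the exponent at which the
    ranks of the powers of N become stationary. There are a row vector v killed
    by N^p and a column vector phi killed by N^p with v N^(p-1) phi <> 0. The
    rows v N^i span an X-stable space on which X acts by a Jordan block of size
    p; the columns N^j phi pair perfectly with it, so their annihilator is an
    X-stable complement, and one concludes by induction on d. *)

Set Implicit Arguments.
Unset Strict Implicit.
Unset Printing Implicit Defensive.

Import Order.TTheory GRing.Theory Num.Theory.
Import numFieldNormedType.Exports.

Local Open Scope classical_set_scope.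
Local Open Scope ring_scope.
Local Open Scope complex_scope.

(** * Jordan normal form *)

(** When the pairing matrix A B is invertible, the row space of A and the left
    kernel of B are complementary; the relations with J and J' say that both
    are stable under X, which is therefore block diagonal in a basis adapted to
    them. *)
Lemma stable_complement (F : fieldType) (n p : nat) (X : 'M[F]_n)
    (A : 'M[F]_(p, n)) (B : 'M[F]_(n, p)) (J J' : 'M[F]_p) :
    A *m B \in unitmx -> A *m X = J *m A -> X *m B = B *m J' ->
  exists q (e : (p + q)%N = n) (P : 'M[F]_n) (X' : 'M[F]_q),
    P \in unitmx /\ P *m X = castmx (e, e) (block_mx J 0 0 X') *m P.
Proof.
move=> ABu AX XB.
have rB : \rank B = p.
  apply/eqP; rewrite eqn_leq rank_leq_col /=.
  by rewrite -{1}(mxrank_unit ABu) mxrankM_maxr.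
(* Naming the codimension q lets n be replaced by p + q, as blocks require. *)
have [q e] : exists q, (p + q)%N = n.
  by exists (n - p)%N; rewrite subnKC // -rB rank_leq_row.
subst n; exists q, erefl.
have [C [Cfree CK]] : exists C : 'M[F]_(q, p + q), row_free C /\ (C :=: kermx B)%MS.
  have rK : \rank (kermx B) = q by rewrite mxrank_ker rB addKn.
  move: (row_base_free (kermx B)) (eq_row_base (kermx B)).
  by move: (row_base _); rewrite rK => C; exists C.
have CB : C *m B = 0 by apply/sub_kermxP; rewrite CK.
have /submxP[X' CX] : (C *m X <= C)%MS.
  by rewrite CK; apply/sub_kermxP; rewrite -mulmxA XB mulmxA CB mul0mx.
exists (col_mx A C), X'; split.
  rewrite -row_free_unit -kermx_eq0.
  have : kermx (col_mx A C) *m col_mx A C = 0 by rewrite mulmx_ker.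
  move: (kermx _) => U; rewrite -(hsubmxK U) mul_row_col => UAC.
  have U1 : lsubmx U = 0.
    have : lsubmx U *m (A *m B) = 0.
      move: UAC => /(congr1 (mulmx^~ B)).
      by rewrite mulmxDl -!mulmxA CB mulmx0 addr0 mul0mx.
    by move/(congr1 (mulmx^~ (invmx (A *m B)))); rewrite mulmxK // mul0mx.
  move: UAC; rewrite U1 mul0mx add0r => /(congr1 (mulmx^~ (pinvmx C))).
  by rewrite -mulmxA mulmxVp // mulmx1 mul0mx => ->; rewrite row_mx0.
by rewrite castmx_id mul_col_mx mul_block_col !mul0mx addr0 add0r AX CX.
Qed.

(** With p.+1 the exponent at which the ranks of the powers of N become
    stationary, suppose K N^p C = 0 for K the left kernel and C the right kernel
    of N^(p.+1). Then K N^p = Z N^(p.+1) for some Z, and Z N^(p.+2) = 0 implies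
    Z N^(p.+1) = 0 by stationarity, so K kills N^p already, against the strict
    drop of rank between the exponents p and p.+1. *)
Lemma dual_chains (F : fieldType) (n : nat) (N : 'M[F]_n) : \rank N != n ->
  exists p (v : 'rV[F]_n) (phi : 'cV[F]_n),
    [/\ v *m N ^+ p.+1 = 0, N ^+ p.+1 *m phi = 0 & (v *m N ^+ p *m phi) 0 0 != 0].
Proof.
move=> Nsing.
have mulN k : N ^+ k.+1 = N ^+ k *m N by rewrite exprSr.
have decr k : (\rank (N ^+ k.+1) <= \rank (N ^+ k))%N.
  by rewrite mulN mxrankM_maxl.
have exk : exists k, \rank (N ^+ k.+1) == \rank (N ^+ k).
  apply: contrapT => nex.
  have le k : (\rank (N ^+ k) + k <= n)%N.
    elim: k => [|k IH]; first by rewrite addn0 rank_leq_row.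
    apply: leq_trans IH; rewrite addnS -addSn leq_add2r ltn_neqAle decr andbT.
    by apply/negP => h; apply: nex; exists k.
  by have := le n.+1; rewrite addnS ltnNge leq_addl.
case: (ex_minnP exk) => -[|p] /eqP rkp minp.
  by move: Nsing; rewrite -{1}[N]expr1 rkp expr0 mxrank1 eqxx.
have lt : (\rank (N ^+ p.+1) < \rank (N ^+ p))%N.
  by rewrite ltn_neqAle decr andbT; apply/negP => /minp; rewrite ltnn.
pose K := kermx (N ^+ p.+1); pose C := cokermx (N ^+ p.+1).
have : K *m N ^+ p *m C != 0.
  apply/negP => /eqP KNC.
  have /submxP[Z KZ] : (K *m N ^+ p <= N ^+ p.+1)%MS by rewrite submxE KNC.
  have ZN : (Z <= kermx (N ^+ p.+2))%MS.
    apply/sub_kermxP.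
    by rewrite (mulN p.+1) mulmxA -KZ -mulmxA -(mulN p) mulmx_ker.
  have kk : (kermx (N ^+ p.+2) <= kermx (N ^+ p.+1))%MS.
    have sub : (kermx (N ^+ p.+1) <= kermx (N ^+ p.+2))%MS.
      by apply/sub_kermxP; rewrite (mulN p.+1) mulmxA mulmx_ker mul0mx.
    by rewrite -(geq_leqif (mxrank_leqif_sup sub)) !mxrank_ker rkp.
  have KN : K *m N ^+ p = 0.
    by rewrite KZ; apply/sub_kermxP; apply: submx_trans kk.
  have /mxrankS : (K <= kermx (N ^+ p))%MS by apply/sub_kermxP.
  rewrite !mxrank_ker leq_sub2lE ?rank_leq_row // leqNgt lt //.
case/matrix0Pn => i [j nz]; exists p, (row i K), (col j C); split.
- by rewrite -row_mul mulmx_ker row0.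
- by rewrite colE mulmxA mulmx_coker mul0mx.
- by rewrite -!row_mul colE mulmxA -colE; rewrite !mxE in nz *.
Qed.

Section Jordan.
Context {R : realType}.
Local Notation K := (Cplx R).

(** The condition at p lets the last row of a Jordan block obey the same
    formula as the other ones. *)
Lemma sum_jordan_row (p : nat) (a : K) (g : nat -> K) (i : 'I_p) : g p = 0 ->
  \sum_(k < p) jordan_block p a i k * g k = a * g i + g i.+1.
Proof.
move=> gp.
rewrite (bigD1 i) //= mxE eqxx; congr (_ + _).
case: (ltnP i.+1 p) => ip.
  rewrite (bigD1 (Ordinal ip)) /=; last by rewrite -val_eqE /= eqn_leq ltnn.
  rewrite mxE -val_eqE /= eqn_leq ltnn eqxx mul1r big1 ?addr0 //= => k /andP[ki kSi].
  by rewrite mxE (negPf ki) -[k == i.+1 :> nat]/(k == Ordinal ip) (negPf kSi) mul0r.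
have -> : i.+1 = p by apply/eqP; rewrite eqn_leq ltn_ord.
rewrite gp big1 // => k ki; rewrite mxE (negPf ki).
by case: eqP => [|]; rewrite ?mul0r // => ek; move: (ltn_ord k); rewrite ek ltnNge ip.
Qed.

Lemma sum_jordan_col (p : nat) (a : K) (g : nat -> K) (j : 'I_p) :
  \sum_(k < p) g k * jordan_block p a k j
  = g j * a + (if (0 < j)%N then g j.-1 else 0).
Proof.
rewrite (bigD1 j) //= mxE eqxx; congr (_ + _).
case: j => -[|j] jp /=.
  by apply: big1 => k kj; rewrite mxE eq_sym (negPf kj) /= mulr0.
have jp' : (j < p)%N by exact: ltnW.
rewrite (bigD1 (Ordinal jp')) /=; last by rewrite -val_eqE /= ltn_eqF.
rewrite mxE -val_eqE /= gtn_eqF // eqxx mulr1 big1 ?addr0 //= => k /andP[kj kj'].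
rewrite mxE eq_sym (negPf kj) /= eqSS.
by move: kj'; rewrite -val_eqE /= eq_sym => /negPf ->; rewrite mulr0.
Qed.

(** The chain of v supplies the block and that of phi, in reverse order, a
    complement. With this order the pairing matrix of the two chains is upper
    triangular with a nonzero constant diagonal, and X acts on both chains by
    the same Jordan block. *)
Lemma jordan_block_splits_off (d : nat) (X : 'M[K]_d) (a : K) : eigenvalue X a ->
  exists p q (e : (p.+1 + q)%N = d) (P : 'M[K]_d) (X' : 'M[K]_q),
    P \in unitmx /\
    P *m X = castmx (e, e) (block_mx (jordan_block p.+1 a) 0 0 X') *m P.
Proof.
move=> Xa; pose N := X - a%:M.
have Nsing : \rank N != d.
  by move: Xa; rewrite /eigenvalue /eigenspace kermx_eq0 -row_leq_rank -ltnNge => /ltn_eqF ->.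
have XN : X = a%:M + N by rewrite addrC subrK.
have [p [v [phi [vN Nphi nz]]]] := dual_chains Nsing.
have vN0 k : (p < k)%N -> v *m N ^+ k = 0.
  by move/subnKC <-; rewrite exprD mulmxA vN mul0mx.
exists p.
pose A : 'M[K]_(p.+1, d) := \matrix_(i, j) (v *m N ^+ i) 0 j.
pose B : 'M[K]_(d, p.+1) := \matrix_(i, j) (N ^+ (p - j) *m phi) i 0.
apply: (@stable_complement _ _ _ X A B _ (jordan_block p.+1 a)).
- have AB i j : (A *m B) i j = (v *m N ^+ (i + (p - j)) *m phi) 0 0.
    rewrite exprD mulmxA -mulmxA [in RHS]mxE mxE; apply: eq_bigr => k _.
    by rewrite !mxE.
  rewrite unitmxE -det_tr det_trig.
    rewrite unitfE; apply/prodf_neq0 => i _.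
    by rewrite mxE AB subnKC ?nz // -ltnS ltn_ord.
  apply/is_trig_mxP => i j ij; rewrite mxE AB vN0 ?mul0mx ?mxE //.
  by rewrite addnC -ltn_subLR ?leq_subr // subKn // -ltnS ltn_ord.
- apply/matrixP => i j; rewrite [RHS]mxE.
  rewrite (eq_bigr (fun k : 'I__ => jordan_block p.+1 a i k * (v *m N ^+ k) 0 j)); last first.
    by move=> k _; rewrite [A k j]mxE.
  rewrite (sum_jordan_row _ (g := fun k => (v *m N ^+ k) 0 j)); last by rewrite vN mxE.
  have -> : (A *m X) i j = (v *m N ^+ i *m X) 0 j.
    by rewrite mxE [RHS]mxE; apply: eq_bigr => k _; rewrite [A i k]mxE.
  by rewrite {1}XN mulmxDr mul_mx_scalar -mulmxA exprSr !mxE.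
- apply/matrixP => i j; rewrite [RHS]mxE.
  rewrite (eq_bigr (fun k : 'I__ => (N ^+ (p - k) *m phi) i 0 * jordan_block p.+1 a k j)); last first.
    by move=> k _; rewrite [B i k]mxE.
  rewrite (sum_jordan_col a (fun k => (N ^+ (p - k) *m phi) i 0)).
  have -> : (X *m B) i j = (X *m (N ^+ (p - j) *m phi)) i 0.
    by rewrite mxE [RHS]mxE; apply: eq_bigr => k _; rewrite [B k j]mxE.
  rewrite {1}XN mulmxDl mul_scalar_mx mulmxA -[N *m _]/(N * _) -exprS.
  rewrite [LHS]mxE; congr (_ + _); first by rewrite mxE mulrC.
  case: j => -[|j] jp /=; first by rewrite subn0 Nphi mxE.
  by rewrite subnSK.
Qed.

(** A single sequence carries the sizes and the eigenvalues: adding a block is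
    consing, and nth at a successor reduces to nth of the tail, so that the
    dependent sizes of the blocks match by computation in the inductive step. *)
Lemma jordan_form (d : nat) (X : 'M[K]_d) :
    (forall a : K, eigenvalue X a -> a \is Num.real) ->
  exists (s : seq (nat * R))
    (e : (\sum_(i < size s) (nth (0%N, 0%R : R) s i).1)%N = d) (W : 'M[K]_d),
    [/\ all (fun x => 0 < x.1)%N s, W \in unitmx &
      W *m X = castmx (e, e) (\mxdiag_(i < size s)
        jordan_block (nth (0%N, 0%R : R) s i).1 ((nth (0%N, 0%R : R) s i).2)%:C) *m W].
Proof.
have [n] := ubnP d; elim: n d X => // n IH d X dn Xreal.
case: (posnP d) => [d0|d_gt0].
  subst d; exists [::].
  have e : (\sum_(i < size (Nil (nat * R))) (nth (0%N, 0%R : R) [::] i).1)%N = 0%N.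
    by rewrite big_ord0.
  exists e, 1%:M; split=> //; first exact: unitmx1.
  by rewrite [LHS]flatmx0 [RHS]flatmx0.
have [a Xa] : exists a, eigenvalue X a.
  have /closed_rootP[a ra] : size (char_poly X) != 1%N.
    by rewrite size_char_poly; case: (d) d_gt0.
  by exists a; rewrite eigenvalue_root_char.
have aE : a = (complex.Re a)%:C.
  by move/Creal_ReP: (Xreal _ Xa) => {1}<-; rewrite complexRe.
have [p [q [e [P [X' [Pu PX]]]]]] := jordan_block_splits_off Xa.
subst d; rewrite castmx_id in PX.
have [||s [e [W [sP Wu WX]]]] := IH q X'.
- by apply: (@leq_trans (p.+1 + q)) => //; rewrite addSn ltnS leq_addl.
- move=> b /eigenvalueP[u ub u0]; apply: Xreal.
  apply/eigenvalueP; exists (row_mx 0 u *m P).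
    rewrite -mulmxA PX mulmxA mul_row_block !mul0mx !mulmx0 !addr0 add0r ub.
    by rewrite scalemxAl scale_row_mx scaler0.
  apply: contraNneq u0 => /(congr1 (mulmx^~ (invmx P))).
  rewrite mulmxK // mul0mx -[X in _ = X -> _](@row_mx0 _ _ p.+1 q).
  by case/eq_row_mx => _ ->.
subst q; rewrite castmx_id in WX.
pose t := (p.+1, complex.Re a) :: s.
have e : (\sum_(i < size t) (nth (0%N, 0%R : R) t i).1)%N
   = (p.+1 + \sum_(i < size s) (nth (0%N, 0%R : R) s i).1)%N.
  by rewrite big_ord_recl.
exists t, e, (block_mx 1%:M 0 0 W *m P); split=> //.
  rewrite unitmx_mul Pu andbT unitmxE det_ublock det1 mul1r.
  by rewrite -unitmxE.
rewrite -mulmxA PX !mulmxA; congr (_ *m _).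
rewrite mxdiag_recl castmx_comp castmx_id /=.
by rewrite !mulmx_block !mul0mx !mulmx0 !mul1mx !mulmx1 !addr0 !add0r WX -aE.
Qed.

End Jordan.

(** * Components of a Jordan decomposition *)

Lemma mul_mxdiag (F : pzSemiRingType) (r : nat) (p : 'I_r -> nat)
    (A B : forall i, 'M[F]_(p i)) :
  \mxdiag_(i < r) A i *m \mxdiag_(i < r) B i = \mxdiag_(i < r) (A i *m B i).
Proof.
rewrite [X in _ *m X]/mxdiag mul_mxdiag_mxblock; apply/eq_mxblock => i j.
by case: eqVneq => [<-|_]; rewrite ?conform_mx_id ?mulmx0.
Qed.

Lemma scale_mxdiag (F : pzSemiRingType) (r : nat) (p : 'I_r -> nat) (c : F)
    (A : forall i, 'M[F]_(p i)) :
  c *: \mxdiag_(i < r) A i = \mxdiag_(i < r) (c *: A i).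
Proof.
rewrite -mul_scalar_mx -mxdiagZ mul_mxdiag.
by apply: eq_mxdiag => i; rewrite mul_scalar_mx.
Qed.

Section JordanComponents.
Context {R : realType}.
Local Notation K := (Cplx R).

(** The l-th power of the nilpotent part of a Jordan block. *)
Definition shift_mx (p l : nat) : 'M[K]_p :=
  \matrix_(i, j) ((nat_of_ord j == i + l)%N)%:R.

Lemma mul_jordan_shift (p l : nat) (a : K) :
  jordan_block p a *m shift_mx p l = a *: shift_mx p l + shift_mx p l.+1.
Proof.
apply/matrixP => i j; pose g k : K := ((nat_of_ord j == k + l)%N)%:R.
have gp : g p = 0 by rewrite /g ltn_eqF // ltn_addr.
rewrite [LHS]mxE (eq_bigr (fun k : 'I_p => jordan_block p a i k * g k)); last first.
  by move=> k _; rewrite [shift_mx _ _ _ _]mxE.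
by rewrite (sum_jordan_row a i gp) !mxE /g addSnnS.
Qed.

Lemma jordan_block_fun_shift (f : R -> K) (p d : nat) (a : R) : (p <= d)%N ->
  jordan_block_fun f p a
  = \sum_(l < d) (cderiv l f a / l`!%:R) *: shift_mx p l.
Proof.
move=> pd; apply/matrixP => i j; rewrite summxE mxE.
case: (leqP i j) => ij.
  have jid : (j - i < d)%N.
    by apply: leq_ltn_trans (leq_subr _ _) (leq_trans _ pd).
  rewrite (bigD1 (Ordinal jid)) //= big1 ?addr0.
    by rewrite !mxE subnKC // eqxx mulr1.
  move=> l; rewrite -val_eqE /= !mxE => /negPf lji.
  by rewrite -{1}(subnKC ij) eqn_add2l eq_sym lji mulr0.
rewrite big1 // => l _; rewrite !mxE ltn_eqF ?mulr0 //.
by rewrite ltn_addr.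
Qed.

(** Separates the coefficients of a block-diagonal matrix with polynomial
    blocks in the shift from the components, which depend on the decomposition
    alone. *)
Lemma mxdiag_shift (r d : nat) (p : 'I_r -> nat) (c : 'I_r -> nat -> K) :
  \mxdiag_(j < r) (\sum_(l < d) c j l *: shift_mx (p j) l)
  = \sum_(i < r) \sum_(l < d)
      c i l *: \mxdiag_(j < r) (if j == i then shift_mx (p j) l else 0).
Proof.
pose S i l (j : 'I_r) : 'M[K]_(p j) := if j == i then shift_mx (p j) l else 0.
transitivity (\mxdiag_(j < r) (\sum_(i < r) \sum_(l < d) c i l *: S i l j)).
  apply: eq_mxdiag => j.
  rewrite (bigD1 j) //= /S eqxx [X in _ + X]big1 ?addr0 // => i ij.
  by rewrite big1 // => l _; rewrite eq_sym (negPf ij) scaler0.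
rewrite mxdiag_sum; apply: eq_bigr => i _; rewrite mxdiag_sum.
by apply: eq_bigr => l _; rewrite scale_mxdiag.
Qed.

(** The relations between X and the components E are all that the computation of
    the exponential uses; the sizes of the blocks and the change of basis are
    forgotten. *)
Lemma spectral_of_matfun (f : R -> K) (d : nat) (X Y : 'M[K]_d) :
    is_matfun f X Y ->
  exists (r : nat) (a : 'I_r -> R) (E : 'I_r -> nat -> 'M[K]_d),
    [/\ 1%:M = \sum_i E i 0,
      forall i l, X *m E i l = (a i)%:C *: E i l + E i l.+1,
      forall i, E i d = 0 &
      Y = \sum_i \sum_(l < d) (cderiv l f (a i) / l`!%:R) *: E i l].
Proof.
case=> r [p [a [e [W [p_gt0 Wu -> ->]]]]]; subst d; rewrite !castmx_id.
exists r, a, (fun i l => W *m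
  \mxdiag_(j < r) (if j == i then shift_mx (p j) l else 0) *m invmx W).
have pd i : (p i <= \sum_(i < r) p i)%N by rewrite (bigD1 i) //= leq_addr.
split.
- rewrite -mulmx_suml -mulmx_sumr -mxdiag_sum.
  rewrite (_ : mxdiag _ = 1%:M) ?mulmx1 ?mulmxV // -mxdiagZ.
  apply: eq_mxdiag => j; rewrite (bigD1 j) //= eqxx big1 ?addr0.
    by apply/matrixP => i k; rewrite !mxE addn0 eq_sym.
  by move=> i ij; rewrite eq_sym (negPf ij).
- move=> i l; rewrite !mulmxA mulmxKV // -(mulmxA W) mul_mxdiag.
  rewrite scalemxAl scalemxAr scale_mxdiag -mulmxDl -mulmxDr -mxdiagD.
  congr (_ *m _ *m _); apply: eq_mxdiag => j.
  case: eqVneq => [->|_]; first exact: mul_jordan_shift.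
  by rewrite mulmx0 scaler0 addr0.
- move=> i; rewrite (_ : mxdiag _ = 0) ?mulmx0 ?mul0mx // -mxdiag0.
  apply: eq_mxdiag => j; case: eqP => // _; apply/matrixP => k k'.
  by rewrite !mxE ltn_eqF // (leq_trans (ltn_ord _)) // (leq_trans (pd j)) // leq_addl.
- under eq_mxdiag => i do rewrite (jordan_block_fun_shift _ _ (pd i)).
  rewrite (mxdiag_shift _ _ (fun i l => cderiv l f (a i) / l`!%:R)).
  rewrite mulmx_sumr mulmx_suml; apply: eq_bigr => i _.
  rewrite mulmx_sumr mulmx_suml; apply: eq_bigr => l _.
  by rewrite -scalemxAr -scalemxAl.
Qed.

(** The value chosen by [matfun] comes from some Jordan decomposition of X, since
    there is one. *)
Lemma matfunP (f : R -> K) (d : nat) (X : 'M[K]_d) :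
    (forall a : K, eigenvalue X a -> a \is Num.real) ->
  is_matfun f X (matfun f X).
Proof.
move=> /jordan_form[s [e [W [sP Wu WX]]]]; apply: (@xgetPex _ _ (is_matfun f X)).
exists (invmx W *m castmx (e, e) (\mxdiag_(i < size s)
  jordan_block_fun f (nth (0%N, 0%R : R) s i).1 (nth (0%N, 0%R : R) s i).2) *m W).
exists (size s), (fun i => (nth (0%N, 0%R : R) s i).1),
  (fun i => (nth (0%N, 0%R : R) s i).2), e, (invmx W).
split; rewrite ?unitmx_inv ?invmxK //.
  by move=> i; move/all_nthP : sP; apply.
by rewrite -mulmxA -WX mulKmx.
Qed.

End JordanComponents.

(** * Powers and exponential of a matrix with given components *)

(** By induction on k, multiplying by X sends the coefficient c(l) of E_(i, l) to
    a_i c(l) + c(l-1), which is Pascal's rule. The bound D.+1 is positive so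
    that the term l = 0 is present. *)
Lemma expr_spectral (F : comNzRingType) (d r D : nat) (X : 'M[F]_d)
    (a : 'I_r -> F) (E : 'I_r -> nat -> 'M[F]_d) (k : nat) :
    1%:M = \sum_i E i 0 ->
    (forall i l, X *m E i l = a i *: E i l + E i l.+1) ->
    (forall i, E i D.+1 = 0) ->
  X ^+ k = \sum_i \sum_(l < D.+1) (a i ^+ (k - l) *+ 'C(k, l)) *: E i l.
Proof.
move=> E0 XE ED; elim: k => [|k IH].
  rewrite expr0 -[1%R]/(1%:M) E0; apply: eq_bigr => i _.
  rewrite big_ord_recl bin0 subnn expr0 scale1r big1 ?addr0 // => l _.
  by rewrite mulr0n scale0r.
rewrite exprS IH -[_ * _]/(_ *m _) mulmx_sumr; apply: eq_bigr => i _.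
pose c k l := a i ^+ (k - l) *+ 'C(k, l).
rewrite mulmx_sumr (eq_bigr (fun l : 'I__ =>
  (a i * c k l) *: E i l + c k l *: E i l.+1)); last first.
  by move=> l _; rewrite -scalemxAr XE scalerDr scalerA mulrC.
rewrite big_split /= [in LHS]big_ord_recl [X in _ + X]big_ord_recr /=.
rewrite ED scaler0 addr0 -addrA -big_split [RHS]big_ord_recl; congr (_ + _).
  by rewrite /c /= !bin0 !subn0 exprS.
apply: eq_bigr => l _ /=; rewrite -scalerDl; congr (_ *: _).
rewrite /c /bump /= add1n subSS binS mulrnDr; congr (_ + _).
rewrite mulrnAr; case: (ltnP l k) => lk; first by rewrite -exprS subnSK.
by rewrite bin_small.
Qed.

Lemma cvg_sum (K : numFieldType) (V : normedModType K) (T I : Type)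
    (F : set_system T) {FF : Filter F} (s : seq I) (f : I -> T -> V) (l : I -> V) :
  (forall i, f i x @[x --> F] --> l i) ->
  \sum_(i <- s) f i x @[x --> F] --> \sum_(i <- s) l i.
Proof.
move=> fl; elim: s => [|i s IH].
  rewrite big_nil (_ : (fun _ => _) = cst 0); first exact: cvg_cst.
  by apply/funext => x; rewrite big_nil.
rewrite big_cons (_ : (fun _ => _) = (fun x => f i x + \sum_(j <- s) f j x)).
  exact: cvgD.
by apply/funext => x; rewrite big_cons.
Qed.

Section ComplexNumbers.
Context {R : realType}.
Local Notation K := (Cplx R).

Lemma cvg_real_complex (T : Type) (F : set_system T) {FF : Filter F}
    (u : T -> R) (a : R) : u x @[x --> F] --> a ->
  ((u x)%:C : K) @[x --> F] --> (a%:C : K).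
Proof.
move=> ua; apply/cvgrPdist_lt => e e0.
have eE : e = (complex.Re e)%:C by rewrite RRe_real // gtr0_real.
move: e0; rewrite eE ltcR => e0.
move/cvgrPdist_lt : ua => /(_ _ e0); apply: filterS => x.
by rewrite -ltcR -rmorphB /= normc_def /= expr0n /= addr0 sqrtr_sqr.
Qed.

Lemma complex_ReDImi (x y : R) : (x +i* y : K) = x%:C + 'i%C * y%:C.
Proof. by rewrite {1}[_ +i* _]complexE. Qed.

Lemma cvg_complex (T : Type) (F : set_system T) {FF : Filter F}
    (u v : T -> R) (a b : R) : u x @[x --> F] --> a -> v x @[x --> F] --> b ->
  (u x +i* v x : K) @[x --> F] --> (a +i* b : K).
Proof.
move=> ua vb; rewrite complex_ReDImi.
rewrite (_ : (fun _ => _) = fun x => (u x)%:C + 'i%C * (v x)%:C : K); last first.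
  by apply/funext => x; rewrite complex_ReDImi.
apply: cvgD; first exact: cvg_real_complex.
by apply: cvgMr; exact: cvg_real_complex.
Qed.

Lemma cexp_imaginary (t : R) : cexp ('i%C * t%:C : K) = cos t +i* sin t.
Proof.
rewrite /cexp /= !(mul0r, mul1r, mulr0, subr0, addr0) expR0 add0r.
by rewrite -[1%:C]/(1 : K) mul1r.
Qed.

(** The powers of i sort the terms of the exponential series into those of the
    cosine and of the sine. *)
Lemma exp_term_imaginary (z : K) (y : R) (n : nat) : z = 'i%C * y%:C ->
  (n`!%:R)^-1 * z ^+ n = cos_coeff y n +i* sin_coeff y n.
Proof.
move=> zE; rewrite complex_ReDImi /cos_coeff /sin_coeff.
have -> : z ^+ n = (-1) ^+ n./2 * 'i%C ^+ odd n * (y ^+ n)%:C.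
  rewrite zE exprMn rmorphXn /= -{1}(odd_double_half n) addnC exprD -mul2n.
  by rewrite exprM sqr_i.
rewrite !rmorphM /= !fmorphV /= !rmorphXn /= !rmorphN1 !rmorph_nat /=.
have : odd n -> n.-1./2 = n./2.
  by move=> no; rewrite -{1}(odd_double_half n) no /= doubleK.
case: (odd n) => [->|_] //=; rewrite !mul0r mul1r ?mulr0 ?add0r ?addr0.
  by rewrite expr1 mulrC -!mulrA mulrCA.
by rewrite expr0 mulr1 mulrC.
Qed.

Lemma cvg_exp_imaginary (y : R) :
  series (fun n => (n`!%:R)^-1 * ('i%C * y%:C) ^+ n : K) @ \oo
    --> cexp ('i%C * y%:C : K).
Proof.
rewrite cexp_imaginary.
rewrite (_ : series _ = fun n => series (cos_coeff y) n +i* series (sin_coeff y) n : K).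
  rewrite unlock; apply: cvg_complex.
    exact: is_cvg_series_cos_coeff.
  by rewrite unlock; exact: is_cvg_series_sin_coeff.
apply/funext => n; rewrite /series /=; elim: n => [|n IH].
  by rewrite !big_geq.
rewrite !big_nat_recr //= IH.
by rewrite (exp_term_imaginary n (erefl _)).
Qed.

End ComplexNumbers.

(** binomial(n, l) / n! = 1 / (l! (n-l)!), so from the index l on this is the
    exponential series of c a, multiplied by c^l / l!. *)
Lemma cvg_shifted_exp_series (K : numFieldType) (c a w : K) (l : nat) :
  series (fun n => (n`!%:R)^-1 * (c * a) ^+ n) @ \oo --> w ->
  series (fun n => (n`!%:R)^-1 * c ^+ n * (a ^+ (n - l) *+ 'C(n, l))) @ \oo
    --> c ^+ l / l`!%:R * w.
Proof.
move=> cw; rewrite -(cvg_shiftn l).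
have fact_neq0 m : m`!%:R != 0 :> K by rewrite pnatr_eq0 -lt0n fact_gt0.
rewrite (_ : (fun _ => _) = fun n =>
  c ^+ l / l`!%:R * series (fun n => (n`!%:R)^-1 * (c * a) ^+ n) n).
  exact: cvgMr.
apply/funext => n; rewrite /series /= (big_cat_nat (n := l)) ?leq_addl //=.
rewrite [X in X + _]big1_seq ?add0r; last first.
  move=> k /andP[_]; rewrite mem_index_iota => /andP[_ kl].
  by rewrite bin_small // mulr0n mulr0.
rewrite -{1}[l]add0n big_addn addnK mulr_sumr.
apply: eq_bigr => k _; rewrite addnK.
have binE : 'C(k + l, l)%:R = (k + l)`!%:R / (l`!%:R * k`!%:R) :> K.
  by rewrite -natrM -(bin_fact (leq_addl k l)) addnK natrM mulfK.
rewrite -[_ *+ 'C(_, _)]mulr_natr binE exprMn exprD.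
by field; rewrite !fact_neq0.
Qed.

Lemma expmx_spectral (K : numFieldType) (d r D : nat) (X : 'M[K]_d)
    (a w : 'I_r -> K) (E : 'I_r -> nat -> 'M[K]_d) (c : K) :
    1%:M = \sum_i E i 0 ->
    (forall i l, X *m E i l = a i *: E i l + E i l.+1) ->
    (forall i, E i D.+1 = 0) ->
    (forall i, series (fun n => (n`!%:R)^-1 * (c * a i) ^+ n) @ \oo --> w i) ->
  expmx (c *: X) = \sum_i \sum_(l < D.+1) (c ^+ l / l`!%:R * w i) *: E i l.
Proof.
move=> E0 XE ED cw; apply: cvg_lim; first exact: norm_hausdorff.
rewrite (_ : series _ = fun n => \sum_i \sum_(l < D.+1)
  series (fun n => (n`!%:R)^-1 * c ^+ n * (a i ^+ (n - l) *+ 'C(n, l))) n *: E i l).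
  apply: cvg_sum => i; apply: cvg_sum => l.
  by apply: cvgZl; exact: cvg_shifted_exp_series.
apply/funext => n; rewrite /series /=.
under [RHS]eq_bigr => i _ do under eq_bigr => l _ do rewrite scaler_suml.
under [RHS]eq_bigr => i _ do rewrite exchange_big /=.
rewrite exchange_big /=; apply: eq_bigr => k _.
have -> : (c *: X) ^+ k = c ^+ k *: X ^+ k.
  elim: k => [|k IH]; first by rewrite !expr0 scale1r.
  rewrite !exprS IH -[_ * _]/(_ *m _) -[X * _]/(X *m _).
  by rewrite -scalemxAl -scalemxAr scalerA.
rewrite (expr_spectral k E0 XE ED) scalerA !scaler_sumr.
apply: eq_bigr => i _; rewrite scaler_sumr; apply: eq_bigr => l _.
by rewrite scalerA.
Qed.

(** * Integration over a period *)

Section Circle.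
Context {R : realType}.
Local Notation mu := (@lebesgue_measure R).
Local Notation Int g := (\int[mu]_(x in `[(- pi : R), pi]) (g x)).

Lemma ltNpi_pi : (- pi : R) < pi.
Proof. by rewrite gt0_cp // pi_gt0. Qed.

(** Every function integrated below is continuous on the whole line, which keeps
    integrability out of the computations. *)
Lemma integrable_circle (g : R -> R) : continuous g ->
  mu.-integrable `[(- pi : R), pi] (EFin \o g).
Proof.
move=> cg; apply: continuous_compact_integrable; first exact: segment_compact.
exact: continuous_subspaceT.
Qed.

Lemma integral_circleD (g h : R -> R) : continuous g -> continuous h ->
  Int (fun x => g x + h x) = Int g + Int h.
Proof. by move=> cg ch; rewrite RintegralD //; exact: integrable_circle. Qed.

Lemma integral_circleZl (c : R) (g : R -> R) : continuous g ->
  Int (fun x => c * g x) = c * Int g.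
Proof. by move=> cg; rewrite RintegralZl //; exact: integrable_circle. Qed.

Lemma integral_circle_cst (c : R) : Int (fun _ => c) = c * (2 * pi).
Proof.
rewrite Rintegral_cst //.
have := @lebesgue_measure_itv R `[- pi, pi]; rewrite /= lte_fin ltNpi_pi => -> /=.
by congr (_ * _); ring.
Qed.

Lemma le_integral_circle (g h : R -> R) : continuous g -> continuous h ->
  (forall x, g x <= h x) -> Int g <= Int h.
Proof.
by move=> cg ch gh; apply: le_Rintegral => //; exact: integrable_circle.
Qed.

Lemma integral_circle_derive (F f : R -> R) : (forall x, is_derive x (1 : R) F (f x)) ->
  continuous f -> Int f = F pi - F (- pi).
Proof.
move=> Ff cf.
have cF : continuous F.
  move=> x; apply: differentiable_continuous; apply/derivable1_diffP.
  exact: ex_derive.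
rewrite /Rintegral (continuous_FTC2 (F := F) ltNpi_pi) //.
- exact: continuous_subspaceT.
- split.
  + by move=> x _; apply: ex_derive.
  + exact: cvg_at_right_filter (cF _).
  + exact: cvg_at_left_filter (cF _).
- by move=> x _; rewrite derive1E; apply: derive_val.
Qed.

(** The vanishing of the boundary terms, on which both orthogonality and
    integration by parts rest. *)
Lemma integral_circle_periodic_derive (F f : R -> R) :
    (forall x, is_derive x (1 : R) F (f x)) -> continuous f ->
  periodic F (2 * pi) -> Int f = 0.
Proof.
move=> Ff cf pF; rewrite (integral_circle_derive Ff cf) -(pF (- pi)).
by rewrite (_ : - pi + 2 * pi = pi) ?subrr //; ring.
Qed.

Lemma is_derive_affine (k a x : R) :
  is_derive x (1 : R) (fun y => k * (y - a)) k.
Proof.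
by apply: is_derive_eq; rewrite subr0 [_ *: _]mulr1.
Qed.

Lemma is_derive_sin_affine (k a x : R) :
  is_derive x (1 : R) (fun y => sin (k * (y - a))) (cos (k * (x - a)) * k).
Proof. exact: (is_derive1_comp _ (is_derive_affine k a x)). Qed.

Lemma is_derive_cos_affine (k a x : R) :
  is_derive x (1 : R) (fun y => cos (k * (y - a))) (- sin (k * (x - a)) * k).
Proof. exact: (is_derive1_comp _ (is_derive_affine k a x)). Qed.

Lemma continuous_cos_affine (k a : R) : continuous (fun y => cos (k * (y - a))).
Proof.
move=> x; apply: differentiable_continuous; apply/derivable1_diffP.
by case: (is_derive_cos_affine k a x).
Qed.

Lemma continuous_sin_affine (k a : R) : continuous (fun y => sin (k * (y - a))).
Proof.
move=> x; apply: differentiable_continuous; apply/derivable1_diffP.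
by case: (is_derive_sin_affine k a x).
Qed.

Lemma periodic_int (V : zmodType) (g : R -> V) (T : R) (k : int) (x : R) :
  periodic g T -> g (x + k%:~R * T) = g x.
Proof.
move=> gT; case: k => n.
  by rewrite -[n%:~R]/(n%:R) mulr_natl periodicn.
by rewrite NegzE mulrNz mulNr -[n.+1%:~R]/(n.+1%:R) mulr_natl -(periodicn gT n.+1) subrK.
Qed.

Lemma cos_2pi : periodic (@cos R) (2 * pi).
Proof. by move=> x; rewrite mulr_natl cosD2pi. Qed.

Lemma sin_2pi : periodic (@sin R) (2 * pi).
Proof. by move=> x; rewrite mulr_natl sinD2pi. Qed.

Lemma integral_circle_cos (n : nat) (a : R) :
  Int (fun x => cos (n.+1%:R * (x - a))) = 0.
Proof.
have n0 : n.+1%:R != 0 :> R by [].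
have : Int (fun x => cos (n.+1%:R * (x - a)) * n.+1%:R) = 0.
  apply: integral_circle_periodic_derive (is_derive_sin_affine _ a) _ _.
    by move=> x; apply: cvgMl; exact: continuous_cos_affine.
  move=> x; rewrite addrAC mulrDr -[X in X * (2 * pi)]/(n.+1%:~R).
  exact: periodic_int sin_2pi.
under eq_Rintegral do rewrite mulrC.
rewrite integral_circleZl; last exact: continuous_cos_affine.
by move/eqP; rewrite mulf_eq0 (negPf n0) => /eqP.
Qed.

End Circle.

(** * Fejér's theorem *)

Section Fejer.
Context {R : realType}.
Local Notation mu := (@lebesgue_measure R).
Local Notation Int g := (\int[mu]_(x in `[(- pi : R), pi]) (g x)).

(** The sum of exp(ikt) over the integers k from -m to m, in real form. *)
Definition dirichlet (m : nat) (t : R) : R :=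
  1 + 2 * \sum_(j < m) cos (j.+1%:R * t).

(** Unnormalised: n times Fejér's kernel. *)
Definition fejer_sum (n : nat) (t : R) : R := \sum_(m < n) dirichlet m t.

Lemma dirichletS m t :
  dirichlet m.+1 t = dirichlet m t + 2 * cos (m.+1%:R * t).
Proof. by rewrite /dirichlet big_ord_recr /= mulrDr addrA. Qed.

(** The product formula makes Dirichlet's kernel times 1 - cos a telescoping
    difference, which avoids quotients by sin(t/2). *)
Lemma dirichlet_cos m t :
  dirichlet m t * (1 - cos t) = cos (m%:R * t) - cos (m.+1%:R * t).
Proof.
elim: m => [|m IH].
  by rewrite /dirichlet big_ord0 mulr0 addr0 mul1r mul0r cos0 mul1r.
rewrite dirichletS mulrDl IH.
have -> : m%:R * t = m.+1%:R * t - t by rewrite -[m.+1]addn1 natrD; ring.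
have -> : m.+2%:R * t = m.+1%:R * t + t by rewrite -[m.+2]addn1 natrD; ring.
by rewrite cosB cosD; ring.
Qed.

Lemma fejer_sum_cos n t : fejer_sum n t * (1 - cos t) = 1 - cos (n%:R * t).
Proof.
rewrite /fejer_sum mulr_suml.
rewrite (eq_bigr (fun m : 'I_n => cos (m%:R * t) - cos (m.+1%:R * t))); last first.
  by move=> m _; rewrite dirichlet_cos.
elim: n => [|n IH]; first by rewrite big_ord0 mul0r cos0 subrr.
by rewrite big_ord_recr /= IH addrA subrK.
Qed.

(** Where cos t < 1 this follows from [fejer_sum_cos]; where cos t = 1, all the
    cosines in the sum are 1. *)
Lemma fejer_sum_ge0 n t : 0 <= fejer_sum n t.
Proof.
have := cos_le1 t; rewrite le_eqVlt => /predU1P[ct|ct].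
  have st : sin t = 0 by apply: cos1sin0; rewrite ct normr1.
  have cos_nt k : cos (k%:R * t) = 1.
    elim: k => [|k IH]; first by rewrite mul0r cos0.
    by rewrite -[k.+1]addn1 natrD mulrDl mul1r cosD IH ct st mulr0 subr0 mulr1.
  apply: sumr_ge0 => m _; apply: addr_ge0 => //; apply: mulr_ge0 => //.
  by apply: sumr_ge0 => j _; rewrite cos_nt.
rewrite -(pmulr_lge0 _ (x := 1 - cos t)) ?subr_gt0 //.
by rewrite fejer_sum_cos subr_ge0 cos_le1.
Qed.

Lemma continuous_dirichlet m a : continuous (fun x => dirichlet m (x - a)).
Proof.
move=> x; apply: cvgD; first exact: cvg_cst.
apply: cvgMr; apply: cvg_sum => j; exact: continuous_cos_affine.
Qed.

Lemma continuous_fejer_sum n a : continuous (fun x => fejer_sum n (x - a)).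
Proof. by move=> x; apply: cvg_sum => j; exact: continuous_dirichlet. Qed.

Lemma integral_circle_sum (n : nat) (g : nat -> R -> R) : (forall j, continuous (g j)) ->
  Int (fun x => \sum_(j < n) g j x) = \sum_(j < n) Int (g j).
Proof.
move=> cg; elim: n => [|n IH].
  under eq_Rintegral do rewrite big_ord0.
  by rewrite big_ord0 integral_circle_cst mul0r.
under eq_Rintegral do rewrite big_ord_recr /=.
rewrite big_ord_recr /= integral_circleD ?IH // => x.
by apply: cvg_sum => j; exact: cg.
Qed.

Lemma integral_circle_dirichlet m a : Int (fun x => dirichlet m (x - a)) = 2 * pi.
Proof.
have cs : continuous (fun x => \sum_(j < m) cos (j.+1%:R * (x - a))).
  by move=> x; apply: cvg_sum => j; exact: continuous_cos_affine.
rewrite /dirichlet integral_circleD; first last.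
- by move=> x; apply: cvgMr; exact: cs.
- by move=> x; exact: cvg_cst.
rewrite integral_circle_cst integral_circleZl //
  (integral_circle_sum _ (g := fun j x => cos (j.+1%:R * (x - a)))).
  by rewrite big1 ?mulr0 ?addr0 ?mul1r // => j _; exact: integral_circle_cos.
by move=> j; exact: continuous_cos_affine.
Qed.

Lemma integral_circle_fejer_sum n a : Int (fun x => fejer_sum n (x - a)) = n%:R * (2 * pi).
Proof.
rewrite /fejer_sum (integral_circle_sum _ (g := fun j x => dirichlet j (x - a))).
  under eq_bigr do rewrite integral_circle_dirichlet.
  by rewrite sumr_const card_ord -[LHS]mulr_natl.
by move=> j; exact: continuous_dirichlet.
Qed.

(** Near a modulo the period continuity gives the bound e. Away from it
    1 - cos(x - a) is bounded below, so a large multiple of it dominates the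
    bounded function h - h(a). By periodicity only |x - a| <= pi matters. *)
Lemma korovkin_bound (h : R -> R) (a e : R) : continuous h ->
    periodic h (2 * pi) -> 0 < e ->
  exists2 M, 0 <= M & forall x, `|h x - h a| <= e + M * (1 - cos (x - a)).
Proof.
move=> ch ph e0.
have pi0 : 0 < pi :> R by exact: pi_gt0.
have [dlt [dlt0 hd]] : exists d0, 0 < d0 /\
    forall x, `|x - a| < d0 -> `|h x - h a| <= e.
  move: (ch a) => /cvgrPdist_le /(_ _ e0) /nbhs_ballP[d0 /= d00 H].
  exists d0; split=> // x xd; rewrite distrC; apply: H => /=.
  by rewrite /ball /= distrC.
have ab : a - pi <= a + pi by lra.
have cg : continuous (fun x => `|h x - h a|).
  by move=> x; apply: cvg_norm; apply: cvgB; [exact: ch|exact: cvg_cst].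
have [c _ hB] := EVT_max ab (continuous_subspaceT (A := `[a - pi, a + pi]) cg).
set B := `|h c - h a| in hB.
have B0 : 0 <= B by exact: normr_ge0.
(* d <= pi, for the cosine decreases only up to pi. *)
pose d := Num.min dlt pi.
have d0 : 0 < d by rewrite lt_min dlt0 pi0.
have dpi : d <= pi by rewrite ge_min lexx orbT.
have cd : 0 < 1 - cos d.
  rewrite subr_gt0 -[ltRHS](@cos0 R) ltr_cos // in_itv /= ?lexx ?(ltW pi0) //.
  by rewrite (ltW d0).
have local t : `|t| <= pi -> `|h (a + t) - h a| <= e + B / (1 - cos d) * (1 - cos t).
  move=> tpi; have [td|dt] := ltP `|t| d.
    apply: le_trans (hd _ _) _.
      by rewrite addrC addKr (lt_le_trans td) // ge_min lexx.
    by rewrite lerDl mulr_ge0 // ?divr_ge0 ?subr_ge0 ?cos_le1 ?(ltW cd).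
  have : B <= B / (1 - cos d) * (1 - cos t).
    rewrite -mulrA ler_peMr // mulrC ler_pdivlMr // mul1r lerB //.
    rewrite -(cos_norm t) leNgt ltr_cos -?leNgt // in_itv /= ?dpi ?(ltW d0) //.
    by rewrite tpi normr_ge0.
  have : `|h (a + t) - h a| <= B.
    by apply: hB; rewrite in_itv /=; move: tpi; rewrite ler_norml; lra.
  lra.
exists (B / (1 - cos d)); first by rewrite divr_ge0 // ltW.
(* k periods are removed to bring x - a into the interval [- pi, pi]. *)
move=> x; pose k := Num.floor ((x - a + pi) / (2 * pi)).
pose t := x - a - k%:~R * (2 * pi).
have xE : x = a + t + k%:~R * (2 * pi) by rewrite /t; ring.
have -> : h x = h (a + t) by rewrite xE (periodic_int _ _ ph).
have -> : cos (x - a) = cos t.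
  by rewrite -(periodic_int k t cos_2pi) /t subrK.
apply: local.
have /andP[] := floor_itv ((x - a + pi) / (2 * pi)).
rewrite -/k ler_pdivlMr ?mulr_gt0 // ltr_pdivrMr ?mulr_gt0 // intrD => k1 k2.
by rewrite ler_norml /t; apply/andP; split; lra.
Qed.

(** Here n P is the mass of the kernel and P the integral of 1 - cos(n(x - a)); the
    two signs of s turn the bound into one on the absolute value. *)
Lemma mean_error_le (n P I H e M : R) : 0 < n -> 0 < P ->
    (forall s, `|s| = 1 ->
      s * (I - H * (n * P)) <= e / 2 * (n * P) + M * P) ->
  M / n <= e / 2 -> `|H - n^-1 * (P^-1 * I)| <= e.
Proof.
move=> n0 P0 bnd Mn.
have nP : 0 < n * P by exact: mulr_gt0.
have -> : H - n^-1 * (P^-1 * I) = - ((n * P)^-1 * (I - H * (n * P))).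
  by field; rewrite !gt_eqF.
rewrite normrN normrM gtr0_norm ?invr_gt0 // ler_pdivrMl //.
have rhs : e / 2 * (n * P) + M * P <= n * P * e.
  have -> : M * P = M / n * (n * P) by field; rewrite gt_eqF.
  by have := ler_wpM2r (ltW nP) Mn; lra.
apply: le_trans rhs; rewrite ler_norml; apply/andP; split.
  by rewrite lerNl -mulN1r; apply: bnd; exact: normrN1.
by rewrite -[leLHS]mul1r; apply: bnd; exact: normr1.
Qed.

(** The bound of [korovkin_bound] is integrated against the nonnegative kernel: its
    constant term e / 2 survives with weight 1, and its term in
    1 - cos(x - a) turns by [fejer_sum_cos] into M / n. *)
Lemma fejer (h : R -> R) (a : R) : continuous h -> periodic h (2 * pi) ->
  (n%:R^-1 * ((2 * pi)^-1 * Int (fun x => h x * fejer_sum n (x - a))))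
    @[n --> \oo] --> h a.
Proof.
move=> ch ph; apply/cvgrPdist_le => e e0.
have pi0 : 0 < pi :> R by exact: pi_gt0.
have e20 : 0 < e / 2 by rewrite divr_gt0.
have [M M0 hM] := korovkin_bound a ch ph e20.
near=> n.
have n0 : 0 < n%:R :> R by rewrite ltr0n; near: n; exists 1%N.
have nM : (M + 1) / (e / 2) <= n%:R by near: n; exact: nbhs_infty_ger.
have cF : continuous (fun x => fejer_sum n (x - a)) by exact: continuous_fejer_sum.
have chF : continuous (fun x => h x * fejer_sum n (x - a)).
  by move=> x; apply: cvgM; [exact: ch|exact: cF].
have c1 : continuous (fun x => 1 - cos (n%:R * (x - a))).
  by move=> x; apply: cvgB; [exact: cvg_cst|exact: continuous_cos_affine].
have i1 : Int (fun x => 1 - cos (n%:R * (x - a))) = 2 * pi.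
  rewrite RintegralB //; first last.
  - apply: integrable_circle; exact: continuous_cos_affine.
  - by apply: integrable_circle => x; exact: cvg_cst.
  by rewrite integral_circle_cst mul1r -[n]prednK ?integral_circle_cos ?subr0 // -(ltr0n R).
have bnd (s : R) : `|s| = 1 ->
    s * (Int (fun x => h x * fejer_sum n (x - a)) - h a * (n%:R * (2 * pi)))
    <= e / 2 * (n%:R * (2 * pi)) + M * (2 * pi).
  move=> s1.
  have -> : s * (Int (fun x => h x * fejer_sum n (x - a)) - h a * (n%:R * (2 * pi)))
      = Int (fun x => s * (h x * fejer_sum n (x - a)) + - (s * h a) * fejer_sum n (x - a)).
    rewrite integral_circleD; first last.
    - by move=> x; apply: cvgMr; exact: cF.
    - by move=> x; apply: cvgMr; exact: chF.
    by rewrite !integral_circleZl // integral_circle_fejer_sum; ring.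
  have -> : e / 2 * (n%:R * (2 * pi)) + M * (2 * pi)
      = Int (fun x => e / 2 * fejer_sum n (x - a) + M * (1 - cos (n%:R * (x - a)))).
    rewrite integral_circleD; first last.
    - by move=> x; apply: cvgMr; exact: c1.
    - by move=> x; apply: cvgMr; exact: cF.
    by rewrite !integral_circleZl // integral_circle_fejer_sum i1.
  apply: le_integral_circle.
  - by move=> x; apply: cvgD; apply: cvgMr; [exact: chF|exact: cF].
  - by move=> x; apply: cvgD; apply: cvgMr; [exact: cF|exact: c1].
  move=> x; rewrite -fejer_sum_cos.
  have -> : s * (h x * fejer_sum n (x - a)) + - (s * h a) * fejer_sum n (x - a)
    = (s * (h x - h a)) * fejer_sum n (x - a) by ring.
  have -> : e / 2 * fejer_sum n (x - a) + M * (fejer_sum n (x - a) * (1 - cos (x - a)))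
    = (e / 2 + M * (1 - cos (x - a))) * fejer_sum n (x - a) by ring.
  apply: ler_wpM2r; first exact: fejer_sum_ge0.
  apply: le_trans (hM x); apply: le_trans (ler_norm _) _.
  by rewrite normrM s1 mul1r.
set I := Int (fun x => h x * fejer_sum n (x - a)) in bnd *.
have Mn : M / n%:R <= e / 2.
  by rewrite ler_pdivrMr //; move: nM; rewrite ler_pdivrMr // mulrC; lra.
apply: mean_error_le bnd Mn => //; exact: mulr_gt0.
Unshelve. all: by end_near. Qed.

End Fejer.

(** * Fourier coefficients and their derivatives *)

Section FourierCoefficients.
Context {R : realType}.
Local Notation K := (Cplx R).
Local Notation mu := (@lebesgue_measure R).
Local Notation Int g := (\int[mu]_(x in `[(- pi : R), pi]) (g x)).

Lemma sum_symm_intsE (V : nmodType) (F : int -> V) (m : nat) :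
  \sum_(k <- symm_ints m) F k = \sum_(j < (2 * m).+1) F (j%:Z - m%:Z).
Proof.
by rewrite /symm_ints big_map -{1}[(2 * m).+1]subn0 -/(index_iota 0 _) big_mkord.
Qed.

Lemma sum_symm_intsS (V : nmodType) (F : int -> V) (m : nat) :
  \sum_(k <- symm_ints m.+1) F k
  = \sum_(k <- symm_ints m) F k + (F m.+1%:Z + F (- m.+1%:Z)).
Proof.
rewrite !sum_symm_intsE.
rewrite mulnS big_ord_recl big_ord_recr /= sub0r.
rewrite addrC -addrA [in RHS]addrC; congr (_ + _).
  apply: eq_bigr => i _; congr F.
  by rewrite /bump /=; lia.
rewrite addrC; congr (_ + _); congr F.
by rewrite /bump /=; lia.
Qed.

Lemma sum_symm_ints0 (V : nmodType) (F : int -> V) :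
  \sum_(k <- symm_ints 0) F k = F 0.
Proof. by rewrite /symm_ints /= big_seq1 subrr. Qed.

(** The Fourier coefficient of a real function, split into real and imaginary
    parts. *)
Definition real_fourier_coef (g : R -> R) (k : int) : K :=
  ((2 * pi)^-1)%:C * (Int (fun x => g x * cos (k%:~R * x))
    +i* - Int (fun x => g x * sin (k%:~R * x))).

Lemma continuous_cosl (k : R) : continuous (fun x => cos (k * x)).
Proof.
rewrite (_ : (fun x => _) = fun x => cos (k * (x - 0))).
  exact: continuous_cos_affine.
by apply/funext => x; rewrite subr0.
Qed.

Lemma continuous_sinl (k : R) : continuous (fun x => sin (k * x)).
Proof.
rewrite (_ : (fun x => _) = fun x => sin (k * (x - 0))).
  exact: continuous_sin_affine.
by apply/funext => x; rewrite subr0.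
Qed.

Lemma continuous_mul (g h : R -> R) : continuous g -> continuous h ->
  continuous (fun x => g x * h x).
Proof. by move=> cg ch x; apply: cvgM; [exact: cg|exact: ch]. Qed.

Lemma continuous_scale (c : R) (g : R -> R) : continuous g ->
  continuous (fun x => c * g x).
Proof. by move=> cg x; apply: cvgMr; exact: cg. Qed.

(** Multiplying by the character at a amounts to translating the trigonometric
    factor under the integral. *)
Lemma real_fourier_coef_cexp (g : R -> R) (k : int) (a : R) : continuous g ->
  real_fourier_coef g k * cexp ('i%C * k%:~R * a%:C : K)
  = ((2 * pi)^-1)%:C * (Int (fun x => g x * cos (k%:~R * (x - a)))
      +i* - Int (fun x => g x * sin (k%:~R * (x - a)))).
Proof.
move=> cg; pose kR : R := k%:~R.
have -> : ('i%C * k%:~R * a%:C : K) = 'i%C * (kR * a)%:C.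
  by rewrite rmorphM /= rmorph_int mulrA.
rewrite cexp_imaginary /real_fourier_coef -mulrA; congr (_ * _).
have cc := continuous_mul cg (@continuous_cosl kR).
have cs := continuous_mul cg (@continuous_sinl kR).
have -> : Int (fun x => g x * cos (kR * (x - a)))
   = cos (kR * a) * Int (fun x => g x * cos (kR * x))
     + sin (kR * a) * Int (fun x => g x * sin (kR * x)).
  rewrite -!integral_circleZl // -integral_circleD;
    [|exact: continuous_scale|exact: continuous_scale].
  by apply: eq_Rintegral => x _; rewrite mulrBr cosB; ring.
have -> : Int (fun x => g x * sin (kR * (x - a)))
   = cos (kR * a) * Int (fun x => g x * sin (kR * x))
     + - sin (kR * a) * Int (fun x => g x * cos (kR * x)).
  rewrite -!integral_circleZl // -integral_circleD;
    [|exact: continuous_scale|exact: continuous_scale].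
  by apply: eq_Rintegral => x _; rewrite mulrBr sinB; ring.
rewrite -/kR; move: (Rintegral _ _ _) (Rintegral _ _ _) (cos _) (sin _) => A B c s.
by apply/eqP; rewrite eq_complex /=; apply/andP; split; apply/eqP; ring.
Qed.

(** The terms k and -k have opposite imaginary parts, so the symmetric sum is real
    and its integrand is Dirichlet's kernel. *)
Lemma real_fourier_sum (g : R -> R) (m : nat) (a : R) : continuous g ->
  \sum_(k <- symm_ints m) real_fourier_coef g k * cexp ('i%C * k%:~R * a%:C : K)
  = ((2 * pi)^-1 * Int (fun x => g x * dirichlet m (x - a)))%:C.
Proof.
move=> cg; rewrite rmorphM /=.
elim: m => [|m IH].
  rewrite sum_symm_ints0 real_fourier_coef_cexp //; congr (_ * _).
  congr (_ +i* _).
    apply: eq_Rintegral => x _.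
    by rewrite mul0r cos0 /dirichlet big_ord0 mulr0 addr0.
  under eq_Rintegral do rewrite mul0r sin0 mulr0.
  by rewrite integral_circle_cst mul0r oppr0.
rewrite sum_symm_intsS IH !real_fourier_coef_cexp // -!mulrDr; congr (_ * _).
pose kR : R := m.+1%:R.
have -> : Int (fun x => g x * cos ((- m.+1%:Z)%:~R * (x - a)))
    = Int (fun x => g x * cos (kR * (x - a))).
  by apply: eq_Rintegral => x _; rewrite mulrNz mulNr cosN.
have -> : Int (fun x => g x * sin ((- m.+1%:Z)%:~R * (x - a)))
    = - Int (fun x => g x * sin (kR * (x - a))).
  rewrite -[RHS]mulN1r -integral_circleZl; last exact: continuous_mul (@continuous_sin_affine _ _ _).
  by apply: eq_Rintegral => x _; rewrite mulrNz mulNr sinN mulN1r mulrN.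
have -> : Int (fun x => g x * dirichlet m.+1 (x - a))
    = Int (fun x => g x * dirichlet m (x - a))
      + 2 * Int (fun x => g x * cos (kR * (x - a))).
  have cc := continuous_mul cg (@continuous_cos_affine _ kR a).
  rewrite -integral_circleZl // -integral_circleD; last exact: continuous_scale.
    by apply: eq_Rintegral => x _; rewrite dirichletS; ring.
  by apply: continuous_mul => //; exact: continuous_dirichlet.
rewrite -[m.+1%:~R]/(m.+1%:R) -/kR.
move: (Rintegral _ _ _) (Rintegral _ _ _) (Rintegral _ _ _) => A B C.
by apply/eqP; rewrite eq_complex /=; apply/andP; split; apply/eqP; ring.
Qed.

Lemma complex_fejer (g : R -> R) (a : R) : continuous g ->
    periodic g (2 * pi) ->
  (n%:R^-1 * \sum_(0 <= m < n) \sum_(k <- symm_ints m)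
      real_fourier_coef g k * cexp ('i%C * k%:~R * a%:C : K)) @[n --> \oo]
    --> ((g a)%:C : K).
Proof.
move=> cg pg.
rewrite (_ : (fun _ => _) = fun n =>
  (n%:R^-1 * ((2 * pi)^-1 * Int (fun x => g x * fejer_sum n (x - a))))%:C : K).
  exact: cvg_real_complex (@fejer R g a cg pg).
apply/funext => n.
rewrite rmorphM fmorphV rmorph_nat; congr (_ * _).
rewrite big_mkord; under eq_bigr do rewrite real_fourier_sum //.
rewrite -rmorph_sum /= -mulr_sumr; congr ((_ * _)%:C).
rewrite -(integral_circle_sum _ (g := fun m x => g x * dirichlet m (x - a))).
  by apply: eq_Rintegral => x _; rewrite mulr_sumr.
by move=> j; apply: continuous_mul => //; exact: continuous_dirichlet.
Qed.

End FourierCoefficients.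

Section Derivatives.
Context {R : realType}.
Local Notation K := (Cplx R).
Local Notation mu := (@lebesgue_measure R).
Local Notation Int g := (\int[mu]_(x in `[(- pi : R), pi]) (g x)).

Lemma is_derive_cosl (k x : R) :
  is_derive x (1 : R) (fun y => cos (k * y)) (- sin (k * x) * k).
Proof.
rewrite (_ : (fun y => _) = fun y => cos (k * (y - 0))).
  by rewrite -[X in sin (k * X)]subr0; exact: is_derive_cos_affine.
by apply/funext => y; rewrite subr0.
Qed.

Lemma is_derive_sinl (k x : R) :
  is_derive x (1 : R) (fun y => sin (k * y)) (cos (k * x) * k).
Proof.
rewrite (_ : (fun y => _) = fun y => sin (k * (y - 0))).
  by rewrite -[X in cos (k * X)]subr0; exact: is_derive_sin_affine.
by apply/funext => y; rewrite subr0.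
Qed.

Lemma is_derive_mul (g h : R -> R) (x dg dh : R) :
  is_derive x (1 : R) g dg -> is_derive x (1 : R) h dh ->
  is_derive x (1 : R) (fun y => g y * h y) (g x * dh + h x * dg).
Proof. exact: is_deriveM. Qed.

Lemma periodic_mul_trig (g t : R -> R) (k : int) :
  periodic g (2 * pi) -> periodic t (2 * pi) ->
  periodic (fun x => g x * t (k%:~R * x)) (2 * pi).
Proof. by move=> pg pt x; rewrite pg mulrDr periodic_int. Qed.

(** Integration by parts: the derivatives of g cos(kx) and of g sin(kx) integrate
    to 0 over a period. *)
Lemma real_fourier_coef_derive (g : R -> R) (k : int) :
    (forall x, derivable g x (1 : R)) -> continuous (derive1 g) ->
    periodic g (2 * pi) ->
  real_fourier_coef (derive1 g) k = 'i%C * k%:~R * real_fourier_coef g k.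
Proof.
move=> dg cdg pg; pose kR : R := k%:~R.
have isg x : is_derive x (1 : R) g ((derive1 g) x).
  by rewrite derive1E; exact: DeriveDef.
have cg : continuous g.
  by move=> x; apply: differentiable_continuous; apply/derivable1_diffP.
have cgc := continuous_mul cg (@continuous_cosl R kR).
have cgs := continuous_mul cg (@continuous_sinl R kR).
have cdc := continuous_mul cdg (@continuous_cosl R kR).
have cds := continuous_mul cdg (@continuous_sinl R kR).
have Ec : Int (fun x => (derive1 g) x * cos (kR * x)) = kR * Int (fun x => g x * sin (kR * x)).
  apply/eqP; rewrite -subr_eq0 -mulNr -integral_circleZl // -integral_circleD //;
    last exact: continuous_scale.
  apply/eqP; apply: integral_circle_periodic_derive (periodic_mul_trig k pg cos_2pi).
    move=> x; apply: is_derive_eq (is_derive_mul (isg x) (is_derive_cosl kR x)) _.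
    by rewrite -/kR; ring.
  by move=> x; apply: cvgD; [exact: cdc|exact: (@continuous_scale R (- kR) _ cgs)].
have Es : Int (fun x => (derive1 g) x * sin (kR * x)) = - kR * Int (fun x => g x * cos (kR * x)).
  apply/eqP; rewrite mulNr -addr_eq0 -integral_circleZl // -integral_circleD //;
    last exact: continuous_scale.
  apply/eqP; apply: integral_circle_periodic_derive (periodic_mul_trig k pg sin_2pi).
    move=> x; apply: is_derive_eq (is_derive_mul (isg x) (is_derive_sinl kR x)) _.
    by rewrite -/kR; ring.
  by move=> x; apply: cvgD; [exact: cds|exact: (@continuous_scale R kR _ cgc)].
rewrite /real_fourier_coef -/kR Ec Es mulrCA; congr (_ * _).
have -> : k%:~R = kR%:C :> K by rewrite rmorph_int.
move: (Rintegral _ _ _) (Rintegral _ _ _) => A B.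
by apply/eqP; rewrite eq_complex /=; apply/andP; split; apply/eqP; ring.
Qed.

Lemma periodic_derive1n (g : R -> R) (T : R) (l : nat) :
  periodic g T -> periodic (derive1n l g) T.
Proof.
move=> pg; elim: l => // l IH; rewrite derive1nS => x.
have E : (fun h => h^-1 *: (derive1n l g (h + (x + T)) - derive1n l g (x + T)))
    = fun h => h^-1 *: (derive1n l g (h + x) - derive1n l g x).
  by apply/funext => h; rewrite addrA !IH.
by rewrite /derive1 E.
Qed.

Lemma is_Cn_real_continuous (n l : nat) (g : R -> R) : is_Cn_real n g ->
  (l <= n)%N -> continuous (derive1n l g).
Proof.
case=> dg cg; rewrite leq_eqVlt => /predU1P[->//|ln] x.
by apply: differentiable_continuous; apply/derivable1_diffP; exact: dg.
Qed.

Lemma real_fourier_coef_derive1n (n l : nat) (g : R -> R) (k : int) :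
    is_Cn_real n g -> periodic g (2 * pi) -> (l <= n)%N ->
  real_fourier_coef (derive1n l g) k
  = ('i%C * k%:~R) ^+ l * real_fourier_coef g k.
Proof.
move=> gC pg; elim: l => [|l IH] ln; first by rewrite expr0 mul1r.
rewrite derive1nS real_fourier_coef_derive.
- by rewrite (IH (ltnW ln)) exprS mulrA.
- by move=> x; apply: gC.1.
- by rewrite -derive1nS; exact: is_Cn_real_continuous gC ln.
- exact: periodic_derive1n.
Qed.

Lemma fourier_coef_real_imag (f : R -> K) (k : int) :
    continuous (rpart f) -> continuous (ipart f) ->
  fourier_coef f k
  = real_fourier_coef (rpart f) k + 'i%C * real_fourier_coef (ipart f) k.
Proof.
move=> cr ci; pose kR : R := k%:~R.
have cexpE x : cexp (- ('i%C * k%:~R * x%:C) : K) = cos (kR * x) +i* - sin (kR * x).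
  have -> : - ('i%C * k%:~R * x%:C) = 'i%C * (- (kR * x))%:C :> K.
    by rewrite rmorphN rmorphM /= rmorph_int mulrN mulrA.
  by rewrite cexp_imaginary cosN sinN.
rewrite /fourier_coef /real_fourier_coef /cintegral mulrCA -mulrDr.
congr (_ * _); rewrite -/kR.
have crc := continuous_mul cr (@continuous_cosl R kR).
have crs := continuous_mul cr (@continuous_sinl R kR).
have cic := continuous_mul ci (@continuous_cosl R kR).
have cis := continuous_mul ci (@continuous_sinl R kR).
have -> : Int (rpart (fun x => f x * cexp (- ('i%C * k%:~R * x%:C))))
    = Int (fun x => rpart f x * cos (kR * x)) + Int (fun x => ipart f x * sin (kR * x)).
  rewrite -integral_circleD //; apply: eq_Rintegral => x _; rewrite /rpart /ipart cexpE.
  by case: (f x) => u v /=; ring.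
have -> : Int (ipart (fun x => f x * cexp (- ('i%C * k%:~R * x%:C))))
    = Int (fun x => ipart f x * cos (kR * x)) + -1 * Int (fun x => rpart f x * sin (kR * x)).
  rewrite -integral_circleZl // -integral_circleD //; last exact: continuous_scale.
  apply: eq_Rintegral => x _; rewrite /rpart /ipart cexpE.
  by case: (f x) => u v /=; ring.
move: (Rintegral _ _ _) (Rintegral _ _ _) (Rintegral _ _ _) (Rintegral _ _ _) => A B C D.
by apply/eqP; rewrite eq_complex /=; apply/andP; split; apply/eqP; ring.
Qed.

(** The limit of Cesàro means is linear in the coefficients; p stands for (ik)^l,
    which multiplies the coefficients u and v of the two parts into those pu and
    pv of their derivatives, q for 1 / l! and w for the character. Stated over
    an abstract field so that the algebra ignores how complex numbers are
    represented. *)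
Lemma cvg_cesaro_combination (F : numFieldType) (c q A B : F)
    (fc u v pu pv p w : int -> F) :
  (forall k, fc k = u k + c * v k) ->
  (forall k, pu k = p k * u k) -> (forall k, pv k = p k * v k) ->
  (N%:R^-1 * \sum_(0 <= m < N) \sum_(k <- symm_ints m) pu k * w k)
    @[N --> \oo] --> A ->
  (N%:R^-1 * \sum_(0 <= m < N) \sum_(k <- symm_ints m) pv k * w k)
    @[N --> \oo] --> B ->
  (N%:R^-1 * \sum_(0 <= m < N) \sum_(k <- symm_ints m) fc k * (p k * q * w k))
    @[N --> \oo] --> (A + c * B) * q.
Proof.
move=> fcE puE pvE uA vB.
pose S g (N : nat) : F :=
  N%:R^-1 * \sum_(0 <= m < N) \sum_(k <- symm_ints m) g k * w k.
rewrite (_ : (fun N => _) = fun N => (S pu N + c * S pv N) * q).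
  by apply: cvgMl; apply: cvgD => //; apply: cvgMr.
apply/funext => N; rewrite /S [X in _ + X]mulrCA -mulrDr -[RHS]mulrA.
congr (_ * _); rewrite mulr_sumr -big_split mulr_suml.
apply: eq_bigr => m _ /=; rewrite mulr_sumr -big_split mulr_suml.
by apply: eq_bigr => k _ /=; rewrite fcE puE pvE; ring.
Qed.

(** The factor (ik)^l turns the coefficients of f into those of its l-th
    derivative, so this is Fejér's theorem for the real and imaginary parts of
    that derivative. *)
Lemma fejer_derivative (n l : nat) (f : R -> K) (a : R) :
    is_Cn n f -> periodic f (2 * pi) -> (l <= n)%N ->
  (N%:R^-1 * \sum_(0 <= m < N) \sum_(k <- symm_ints m) fourier_coef f k *
      (('i%C * k%:~R) ^+ l / l`!%:R * cexp ('i%C * k%:~R * a%:C : K))) @[N --> \oo]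
    --> (cderiv l f a / l`!%:R : K).
Proof.
move=> [fr fi] pf ln.
have pr : periodic (rpart f) (2 * pi) by move=> x; rewrite /rpart pf.
have pi_ : periodic (ipart f) (2 * pi) by move=> x; rewrite /ipart pf.
have [cr0 ci0] : continuous (rpart f) /\ continuous (ipart f).
  by split; [exact: is_Cn_real_continuous fr (leq0n n)
            |exact: is_Cn_real_continuous fi (leq0n n)].
have crl : continuous (derive1n l (rpart f)) by exact: is_Cn_real_continuous fr ln.
have cil : continuous (derive1n l (ipart f)) by exact: is_Cn_real_continuous fi ln.
have cvr := @complex_fejer R _ a crl (periodic_derive1n l pr).
have cvi := @complex_fejer R _ a cil (periodic_derive1n l pi_).
have cdE : cderiv l f a = (derive1n l (rpart f) a)%:C
    + 'i%C * (derive1n l (ipart f) a)%:C :> K by exact: complex_ReDImi.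
rewrite cdE.
have fcE k := fourier_coef_real_imag k cr0 ci0.
have rE k := real_fourier_coef_derive1n k fr pr ln.
have iE k := real_fourier_coef_derive1n k fi pi_ ln.
have H := cvg_cesaro_combination (q := (l`!%:R : K)^-1) fcE rE iE cvr cvi.
exact: H.
Qed.

End Derivatives.

(** * Cesàro means of the matrix Fourier series *)

Lemma expmx_imaginary (R : realType) (d r : nat) (X : 'M[Cplx R]_d.+1)
    (a : 'I_r -> R) (E : 'I_r -> nat -> 'M[Cplx R]_d.+1) (k : int) :
    1%:M = \sum_i E i 0 ->
    (forall i l, X *m E i l = (a i)%:C *: E i l + E i l.+1) ->
    (forall i, E i d.+1 = 0) ->
  expmx (('i%C * k%:~R) *: X) = \sum_i \sum_(l < d.+1)
    (('i%C * k%:~R) ^+ l / l`!%:R * cexp ('i%C * k%:~R * (a i)%:C : Cplx R)) *: E i l.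
Proof.
move=> E0 XE ED; apply: (expmx_spectral E0 XE ED) => i.
have -> : ('i%C * k%:~R * (a i)%:C : Cplx R) = 'i%C * (k%:~R * a i)%:C.
  by rewrite rmorphM /= rmorph_int mulrA.
exact: cvg_exp_imaginary.
Qed.

Theorem proposition3p6 (R : realType) (d : nat) (d_gt0 : (0 < d)%N)
    (X : 'M[Cplx R]_d)
    (X_real : forall a : Cplx R, eigenvalue X a -> a \is Num.real)
    (f : R -> Cplx R) (f_C : is_Cn d.-1 f) (f_per : periodic f (2 * pi)) :
  (n%:R^-1 *: \sum_(0 <= m < n) \sum_(k <- symm_ints m)
      fourier_coef f k *: expmx (('i%C * k%:~R) *: X)) @[n --> \oo]
    --> matfun f X.
Proof.
case: d => // d in d_gt0 X X_real f_C *; rewrite /= in f_C.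
have [r [a [E [E0 XE ED ->]]]] := spectral_of_matfun (matfunP f X_real).
pose c (k : int) i (l : nat) : Cplx R :=
  ('i%C * k%:~R) ^+ l / l`!%:R * cexp ('i%C * k%:~R * (a i)%:C : Cplx R).
rewrite (_ : (fun n => _) = fun n => \sum_i \sum_(l < d.+1)
  (n%:R^-1 * \sum_(0 <= m < n) \sum_(k <- symm_ints m)
    fourier_coef f k * c k i l) *: E i l).
  apply: cvg_sum => i; apply: cvg_sum => l; apply: cvgZl.
  by apply: fejer_derivative f_C f_per _; rewrite -ltnS.
apply/funext => n; 
(* Flattening the double sum leaves a single exchange of summations. *)
pose s := [seq k | m <- iota 0 n, k <- symm_ints m].
have flat (V : nmodType) (F : int -> V) :
    \sum_(0 <= m < n) \sum_(k <- symm_ints m) F k = \sum_(k <- s) F k.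
  by rewrite big_allpairs_dep /= /index_iota subn0.
rewrite flat (eq_bigr (fun k => \sum_i \sum_(l < d.+1)
    (fourier_coef f k * c k i l) *: E i l)); last first.
  move=> k _; rewrite (expmx_imaginary k E0 XE ED) scaler_sumr.
  apply: eq_bigr => i _; rewrite scaler_sumr; apply: eq_bigr => l _.
  by rewrite scalerA.
rewrite exchange_big scaler_sumr; apply: eq_bigr => i _ /=.
rewrite exchange_big scaler_sumr; apply: eq_bigr => l _ /=.
by rewrite flat -scaler_suml scalerA.
Qed.
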